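(* For $x\in(0,27/4)$ put $z=4x/27$. Then \[ V_{3,0}(x)=\frac{\left(1+\sqrt{1-z}\right)^{1/3}}{9\pi\sqrt{3(1-z)}}z^{-2/3}+\frac{\left(1+\sqrt{1-z}\right)^{-1/3}}{9\pi\sqrt{3(1-z)}}z^{-1/3}, \] \[ V_{3,1}(x)=\frac{\left(1+\sqrt{1-z}\right)^{2/3}}{6\pi\sqrt{3(1-z)}}z^{-1/3}+\frac{\left(1+\sqrt{1-z}\right)^{-2/3}}{6\pi\sqrt{3(1-z)}}z^{1/3}, \] \[ V_{3,2}(x)=\frac{\left(1+\sqrt{1-z}\right)^{1/3}}{4\pi\sqrt{3(1-z)}}z^{1/3}+\frac{\left(1+\sqrt{1-z}\right)^{-1/3}}{4\pi\sqrt{3(1-z)}}z^{2/3}. \]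
   Context: For $a\in\mathbb{R}$ and $n\in\{0,1,2,\ldots\}$, $\binom{a}{n}:=a(a-1)\cdots(a-n+1)/n!$. For rational $p>1$ and $-1<r\le p-1$ there is a unique probability measure $\nu(p,r)$ with moments $\int x^n\,d\nu(p,r)(x)=\binom{np+r}{n}$, $n\ge0$; it is absolutely continuous and supported on $[0,c(p)]$, $c(p)=p^p(p-1)^{1-p}$ (so $c(3)=27/4$). $V_{p,r}$ denotes its (continuous on $(0,c(p))$) density. *)

(* Defs.v *)
From HB Require Import structures.
From mathcomp Require Import all_boot all_order all_algebra.
From mathcomp Require Import all_classical all_reals all_analysis.
Set Implicit Arguments.
Unset Strict Implicit.
Unset Printing Implicit Defensive.
Import Order.TTheory GRing.Theory Num.Theory.
Import numFieldNormedType.Exports.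
Local Open Scope classical_set_scope.
Local Open Scope ring_scope.

Definition gbinom (R : realType) (a : R) (n : nat) : R :=
  (\prod_(i < n) (a - i%:R)) / n`!%:R.

Definition has_binomial_moments (R : realType) (p r : R)
    (mu : probability (measurableTypeR R) R) : Prop :=
  forall n : nat,
    mu.-integrable setT (fun x : R => (x ^+ n)%:E) /\
    (\int[mu]_x (x ^+ n)%:E = (gbinom (n%:R * p + r) n)%:E)%E.

(* For rational p > 1 and -1 < r <= p - 1 exactly one probability measure has
   these moments; elsewhere the value may be the default point (a Dirac). *)
Definition nu (R : realType) (p r : R) :
    probability (measurableTypeR R) R :=
  get [set mu | has_binomial_moments p r mu].

Definition support_end (R : realType) (p : R) : R :=
  p `^ p * (p - 1) `^ (1 - p).

(* Being a density determines f only almost everywhere; continuity on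
   ]0, support_end p[ makes it unique at every point of that interval. *)
Definition is_cont_density (R : realType) (p : R)
    (mu : probability (measurableTypeR R) R) (f : R -> R) : Prop :=
  [/\ measurable_fun setT f,
      forall x, 0 <= f x,
      forall A : set (measurableTypeR R), measurable A ->
        (mu A = \int[lebesgue_measure]_(x in A) (f x)%:E)%E &
      forall x, 0 < x < support_end p -> {for x, continuous f}].

(* The values of V p r outside ]0, support_end p[ are not meaningful. *)
Definition V (R : realType) (p r : R) : R -> R :=
  get [set f | is_cont_density p (nu p r) f].

(* Main.v *)
(* Put X(u) = 27 u^3 / (1 + u^3)^2, an increasing bijection of [0, 1] onto
   [0, 27/4].  At x = X(u), with c^3 = 2 / (1 + u^3), one has
   1 + sqrt(1 - z) = c^3 and z = (c^2 u)^3, so the three claimed densities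
   become rational: V(X(u)) X'(u) = w(u) with

     w0 = 3 sqrt 3 / (2 pi (1 - u + u^2)),
     w1 = 9 sqrt 3 (u + u^3) / (2 pi (1 + u^3)^2),
     w2 = X w0 / 3.

   The n-th moment is thus the integral of X^n w over [0, 1].  Explicit
   antiderivatives relate consecutive moments by the recurrences satisfied by
   the binomial coefficients, and the integral of w0 is an arctangent.

   Conversely, a probability measure on R whose even moments are O(c^(2n)) lives
   on [-c, c] and is determined by its moments, because the indicator of
   ]-oo, a[ is there a bounded pointwise limit of the polynomials
   (1 - y^k)^(k 2^k), with y affine in x and y = 1/2 at x = a.  Hence nu(3, r)
   has the claimed density, and two densities that are continuous on
   ]0, 27/4[ agree everywhere on that interval. *)

Require Import Defs.
From HB Require Import structures.
From mathcomp Require Import all_boot all_order all_algebra.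
From mathcomp Require Import all_classical all_reals all_analysis.
From mathcomp Require Import measurable_realfun zify ring lra.
Set Implicit Arguments.
Unset Strict Implicit.
Unset Printing Implicit Defensive.
Import Order.TTheory GRing.Theory Num.Theory.
Import numFieldNormedType.Exports.
Local Open Scope classical_set_scope.
Local Open Scope ring_scope.

(** * Differentiation and integration of explicit functions *)

Section calculus.
Context {R : realType}.
Implicit Types (f g G : R -> R) (u a b : R).

Lemma is_derive_mul f g u a b : is_derive u 1 f a -> is_derive u 1 g b ->
  is_derive u 1 (fun t => f t * g t) (a * g u + f u * b).
Proof.
move=> fa gb; apply: (is_derive_eq (is_deriveM fa gb)).
by rewrite addrC /GRing.scale/= [g u * a]mulrC.
Qed.

Lemma is_derive_add f g u a b : is_derive u 1 f a -> is_derive u 1 g b ->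
  is_derive u 1 (fun t => f t + g t) (a + b).
Proof. by move=> fa gb; exact: is_deriveD. Qed.

Lemma is_derive_opp f u a : is_derive u 1 f a ->
  is_derive u 1 (fun t => - f t) (- a).
Proof. by move=> fa; exact: is_deriveN. Qed.

Lemma is_derive_exp f u a n : is_derive u 1 f a ->
  is_derive u 1 (fun t => f t ^+ n) (n%:R * f u ^+ n.-1 * a).
Proof.
by move=> fa; rewrite -exprfctE; exact: is_deriveX.
Qed.

Lemma is_derive_inv f u a : f u != 0 -> is_derive u 1 f a ->
  is_derive u 1 (fun t => (f t)^-1) (- (f u ^- 2) * a).
Proof. by move=> fu0 fa; exact: is_deriveV. Qed.

Lemma is_derive_const u a : is_derive u 1 (fun=> a) 0.
Proof. exact: is_derive_cst. Qed.

Lemma is_derive_idfun u : is_derive u 1 (fun t => t) 1.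
Proof. exact: is_derive_id. Qed.

Lemma is_derive_continuous f u a : is_derive u 1 f a -> {for u, continuous f}.
Proof.
by move=> [fu _]; apply/differentiable_continuous/derivable1_diffP.
Qed.

Lemma Rintegral_antiderivative f G a b : a < b ->
  (forall u, a <= u <= b -> is_derive u 1 G (f u)) ->
  (forall u, a <= u <= b -> {for u, continuous f}) ->
  \int[lebesgue_measure]_(u in `[a, b]) f u = G b - G a.
Proof.
move=> ab dG cf.
rewrite /Rintegral (@continuous_FTC2 R f G a b)//.
- by apply: continuous_in_subspaceT => u /[!inE]/= /[!in_itv]/=; exact: cf.
- have cG u : a <= u <= b -> {for u, continuous G}.
    by move=> /dG; exact: is_derive_continuous.
  split.
  + move=> u; rewrite in_itv/= => /andP[au ub].
    by have [] := dG u; rewrite ?(ltW au) ?(ltW ub).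
  + by apply: cvg_at_right_filter; apply: cG; rewrite lexx ltW.
  + by apply: cvg_at_left_filter; apply: cG; rewrite lexx ltW.
- move=> u; rewrite in_itv/= => /andP[au ub].
  have := dG u; rewrite (ltW au) (ltW ub) => /(_ isT) [? <-].
  by rewrite derive1E.
Qed.

End calculus.

(* [notypeclasses] keeps [is_derive] premises as subgoals: instance search on
   them diverges because the derivative is still an evar. *)
Ltac derive_step := lazymatch goal with
  | |- is_derive _ _ (fun=> ?c) _ =>
      notypeclasses refine (is_derive_const _ _)
  | |- is_derive _ _ (fun t => t) _ =>
      notypeclasses refine (is_derive_idfun _)
  | |- is_derive _ _ (fun t => @?f t + @?g t) _ =>
      notypeclasses refine (@is_derive_add _ f g _ _ _ _ _)
  | |- is_derive _ _ (fun t => - @?f t) _ =>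
      notypeclasses refine (@is_derive_opp _ f _ _ _)
  | |- is_derive _ _ (fun t => @?f t * @?g t) _ =>
      notypeclasses refine (@is_derive_mul _ f g _ _ _ _ _)
  | |- is_derive _ _ (fun t => @?f t ^+ _) _ =>
      notypeclasses refine (@is_derive_exp _ f _ _ _ _)
  | |- is_derive _ _ (fun t => (@?f t)^-1) _ =>
      notypeclasses refine (@is_derive_inv _ f _ _ _ _)
  end.

(** * The substitution x = X(u) and its moments *)

Section substitution.
Context {R : realType}.
Implicit Types u : R.
Local Notation leb := (@lebesgue_measure R).

Definition cubic_map u : R := 27 * u ^+ 3 / (1 + u ^+ 3) ^+ 2.
Local Notation X := cubic_map.

Definition weight0 u : R :=
  3 * Num.sqrt 3 / (2 * pi) / (1 - u + u ^+ 2).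
Definition weight1 u : R :=
  9 * Num.sqrt 3 / (2 * pi) * ((u + u ^+ 3) / (1 + u ^+ 3) ^+ 2).
Definition weight2 u : R := X u / 3 * weight0 u.

Lemma cube_add1_gt0 u : 0 <= u -> 0 < 1 + u ^+ 3.
Proof. by move=> u0; rewrite ltr_pwDl// exprn_ge0. Qed.

Lemma quad_gt0 u : 0 < 1 - u + u ^+ 2.
Proof. by have := sqr_ge0 (2 * u - 1); nra. Qed.

Lemma is_derive_cubic_map u : 0 <= u ->
  is_derive u 1 X (81 * u ^+ 2 * (1 - u ^+ 3) / (1 + u ^+ 3) ^+ 3).
Proof.
move=> u0; have /lt0r_neq0 d0 := cube_add1_gt0 u0.
rewrite /X; notypeclasses refine (is_derive_eq _ _).
  by repeat derive_step; rewrite ?expf_neq0.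
rewrite /=; field; exact: d0.
Qed.

(* u X'(u) = 3 X(u) (1 - u^3) / (1 + u^3), so a factor u makes the derivative
   of a power of X a multiple of the same power. *)
Lemma is_derive_cubic_mapX n g u a : 0 <= u -> is_derive u 1 g a ->
  is_derive u 1 (fun t => X t ^+ n * (t * g t))
    (X u ^+ n * (3 * n%:R * (1 - u ^+ 3) / (1 + u ^+ 3) * g u + g u + u * a)).
Proof.
move=> u0 ga; have /lt0r_neq0 d0 := cube_add1_gt0 u0.
notypeclasses refine (is_derive_eq _ _).
  by repeat (first [exact: ga | exact: is_derive_cubic_map | derive_step]).
(* The power rule yields the exponent [n.-1], which is one less than [n] only for positive [n]. *)
case: n => [|n]; first by rewrite /= !expr0; ring.
rewrite /= [X u ^+ n.+1]exprS.
by move: (X u ^+ n) (g u) => Y b; rewrite /X; field.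
Qed.

Lemma continuous_cubic_map u : 0 <= u -> {for u, continuous X}.
Proof. by move/is_derive_cubic_map/is_derive_continuous. Qed.

Lemma continuous_weight0 u : {for u, continuous weight0}.
Proof.
notypeclasses refine (is_derive_continuous _); rewrite /weight0.
by repeat derive_step; rewrite lt0r_neq0// quad_gt0.
Qed.

Lemma continuous_weight1 u : 0 <= u -> {for u, continuous weight1}.
Proof.
move=> u0; notypeclasses refine (is_derive_continuous _); rewrite /weight1.
by repeat derive_step; rewrite expf_neq0// lt0r_neq0// cube_add1_gt0.
Qed.

Lemma continuous_weight2 u : 0 <= u -> {for u, continuous weight2}.
Proof.
move=> u0; apply: continuousM; last exact: continuous_weight0.
by apply: continuousM; [exact: continuous_cubic_map|exact: cst_continuous].
Qed.

(** For this angle t, cos^2 t = 3/4, so cos 2t = 1/2 = sin t = cos (pi/2 - t). Injectivity of the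
    cosine on [0, pi] then gives 2t = pi/2 - t. *)
Lemma atan_inv_sqrt3 : atan (Num.sqrt 3)^-1 = pi / 6 :> R.
Proof.
set t := atan _.
have s3 : Num.sqrt 3 ^+ 2 = 3 :> R by rewrite sqr_sqrtr.
have t0 : 0 < t by rewrite -atan0 lt_atan// invr_gt0 sqrtr_gt0.
have tpi : t < pi / 2 by exact: atan_ltpi2.
have c2 : cos t ^+ 2 = 3 / 4.
  rewrite cos_atan exprVn sqr_sqrtr; last by rewrite addr_ge0// sqr_ge0.
  rewrite exprVn s3; by field.
have c3 : cos (t *+ 2) = 1 / 2.
  by rewrite cos_mulr2n c2; lra.
have sc : sin (pi / 2 - t) = cos t.
  by rewrite sinB sin_pihalf cos_pihalf; ring.
have ct : cos (pi / 2 - t) = sin t.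
  by rewrite cosB sin_pihalf cos_pihalf; ring.
have st0 : 0 < sin t by apply: sin_gt0_pihalf; rewrite t0.
have s2 : sin t ^+ 2 = 1 / 4 by rewrite sin2cos2 c2; lra.
have st : sin t = 1 / 2 by nra.
have : cos (t *+ 2) = cos (pi / 2 - t) by rewrite ct st c3; lra.
move/cos_inj; rewrite !in_itv/= => H.
by have : t *+ 2 = pi / 2 - t; [apply: H; apply/andP; split; lra|lra].
Qed.

(** Completing the square in 1 - u + u^2 leads to the primitive [G], whose values at 1 and 0 are 1/2
    and -1/2 by [atan_inv_sqrt3]. *)
Lemma Rintegral_weight0 : \int[leb]_(u in `[0, 1]) weight0 u = 1.
Proof.
have s3 : Num.sqrt 3 ^+ 2 = 3 :> R by rewrite sqr_sqrtr.
have s0 : Num.sqrt 3 != 0 :> R by rewrite gt_eqF// sqrtr_gt0.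
have p0 : pi != 0 :> R by rewrite gt_eqF// pi_gt0.
pose G u : R := 3 / pi * atan ((2 * u - 1) / Num.sqrt 3).
notypeclasses refine
  (etrans (@Rintegral_antiderivative _ _ G _ _ ltr01 _ _) _).
- move=> u _.
  have q0 := lt0r_neq0 (quad_gt0 u).
  rewrite /G/weight0.
  notypeclasses refine (is_derive_eq _ _).
    derive_step; first exact: is_derive_const.
    by notypeclasses refine (is_derive1_comp _ _); repeat derive_step.
  have q : 1 + ((2 * u - 1) / Num.sqrt 3) ^+ 2 = 4 / 3 * (1 - u + u ^+ 2).
    by rewrite expr_div_n s3; field.
  (* [field] does not know the square of [Num.sqrt 3]. With [9 / Num.sqrt 3] in place of
     [3 * Num.sqrt 3] the identity holds for any nonzero value of the root. *)
  rewrite /= derive_val q -[3 * Num.sqrt 3](_ : 9 / Num.sqrt 3 = _); last first.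
    by apply: (mulIf s0); rewrite divfK// -mulrA -expr2 s3; ring.
  by move: pi p0 => p p0; field; rewrite q0 p0 s0.
- by move=> u _; exact: continuous_weight0.
- rewrite /G !mulr1 mulr0 sub0r mulN1r atanN.
  rewrite (_ : 2 - 1 = 1 :> R); last by lra.
  by rewrite mul1r atan_inv_sqrt3; move: pi p0 => p p0; field.
Qed.

Definition moment (w : R -> R) (n : nat) : R :=
  \int[leb]_(u in `[0, 1]) (X u ^+ n * w u).

Lemma continuous_cubic_mapX_mul n (w : R -> R) u : 0 <= u ->
  {for u, continuous w} -> {for u, continuous (fun t => X t ^+ n * w t)}.
Proof.
move=> u0 cw; apply: (@continuousM _ _ (fun t => X t ^+ n)) => //.
apply: (@continuous_comp _ _ _ X (fun t => t ^+ n)).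
  exact: continuous_cubic_map.
exact: exprn_continuous.
Qed.

Lemma integrable_moment (w : R -> R) n :
  (forall u, 0 <= u -> {for u, continuous w}) ->
  leb.-integrable `[0, 1] (EFin \o (fun u => X u ^+ n * w u)).
Proof.
move=> cw; apply: continuous_compact_integrable; first exact: segment_compact.
apply: continuous_in_subspaceT => u /[!inE]/= /[!in_itv]/= /andP[u0 _].
exact/continuous_cubic_mapX_mul/cw.
Qed.

(** Linear relations between moments come from a [G] vanishing at both ends of [0, 1], since the
    integral of its derivative is then zero. *)
Lemma moment_antiderivative (w w' G : R -> R) n m a b :
  (forall u, 0 <= u -> {for u, continuous w}) ->
  (forall u, 0 <= u -> {for u, continuous w'}) ->
  (forall u, 0 <= u ->
    is_derive u 1 G (a * (X u ^+ n * w u) - b * (X u ^+ m * w' u))) ->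
  G 0 = 0 -> G 1 = 0 -> a * moment w n = b * moment w' m.
Proof.
move=> cw cw' dG G0 G1; apply/eqP; rewrite -subr_eq0 /moment.
have iw := integrable_moment n cw; have iw' := integrable_moment m cw'.
rewrite -!RintegralZl// -RintegralB//; last 2 first.
  exact: (integrableZl _ a iw).
  exact: (integrableZl _ b iw').
apply/eqP; notypeclasses refine
  (etrans (@Rintegral_antiderivative _ _ G _ _ ltr01 _ _) _).
- by move=> u /andP[u0 _]; exact: dG.
- move=> u /andP[u0 _]; apply: continuousB;
    (apply: continuousM; first exact: cst_continuous).
    exact/continuous_cubic_mapX_mul/cw.
  exact/continuous_cubic_mapX_mul/cw'.
- by rewrite G0 G1 subrr.
Qed.

(* For G, u = (t / (1 - t))^(1/3) turns the moments into incomplete Beta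
   integrals; G comes from the antiderivative
   t^(n+1/3) (1-t)^(n+2/3) (9n + 6 - 9 (2n+1) t), antisymmetrised under
   t <-> 1 - t since u ranges over [0, 1] instead of [0, +oo[. *)
Lemma moment_weight0S n :
  2 * (n%:R + 1) * (2 * n%:R + 1) * moment weight0 n.+1 =
  3 * (3 * n%:R + 1) * (3 * n%:R + 2) * moment weight0 n.
Proof.
have p0 : pi != 0 :> R by rewrite gt_eqF// pi_gt0.
pose c : R := 3 * Num.sqrt 3 / (2 * pi).
pose g u : R := (1 + u ^+ 3)^-1 * ((9 * n%:R + 6) * (1 - u) -
  9 * (2 * n%:R + 1) * (u ^+ 3 - u) / (1 + u ^+ 3)) * (- c).
pose G u := X u ^+ n * (u * g u).
notypeclasses refine (@moment_antiderivative _ _ G _ _ _ _ _ _ _ _ _).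
- by move=> u _; exact: continuous_weight0.
- by move=> u _; exact: continuous_weight0.
- move=> u u0; have /lt0r_neq0 d0 := cube_add1_gt0 u0.
  have q0 := lt0r_neq0 (quad_gt0 u).
  notypeclasses refine (is_derive_eq _ _).
    notypeclasses refine (is_derive_cubic_mapX _ u0 _).
    by rewrite /g; repeat derive_step.
  rewrite [X u ^+ n.+1]exprS; move: (X u ^+ n) => Y.
  by rewrite /X /weight0 /g -/c; field; rewrite q0 d0.
- by rewrite /G mul0r mulr0.
- by rewrite /G /g expr1n !subrr; ring.
Qed.

(** The factor (3n+1)/(2n+1) is the ratio of binom(3n+1, n) to binom(3n, n). In the antiderivative c
    X^n u (u-1)/(1+u^3) the factors u and u-1 vanish at the two ends. *)
Lemma moment_weight1 n :
  (2 * n%:R + 1) * moment weight1 n = (3 * n%:R + 1) * moment weight0 n.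
Proof.
have p0 : pi != 0 :> R by rewrite gt_eqF// pi_gt0.
pose c : R := 3 * Num.sqrt 3 / (2 * pi).
pose g u : R := (u - 1) / (1 + u ^+ 3) * c.
pose G u := X u ^+ n * (u * g u).
notypeclasses refine (@moment_antiderivative _ _ G _ _ _ _ _ _ _ _ _).
- exact: continuous_weight1.
- by move=> u _; exact: continuous_weight0.
- move=> u u0; have /lt0r_neq0 d0 := cube_add1_gt0 u0.
  have q0 := lt0r_neq0 (quad_gt0 u).
  notypeclasses refine (is_derive_eq _ _).
    notypeclasses refine (is_derive_cubic_mapX _ u0 _).
    by rewrite /g; repeat derive_step.
  rewrite /weight0 /weight1 /g.
  rewrite (_ : 9 * Num.sqrt 3 / (2 * pi) = 3 * c); last first.
    by rewrite /c; move: pi p0 => p p0; field.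
  rewrite -/c.
  by move: (X u ^+ n) => Y; field; rewrite q0 d0.
- by rewrite /G mul0r mulr0.
- by rewrite /G /g expr1n !subrr; ring.
Qed.

(** [weight2] is designed for 3 binom(3n+2, n) = binom(3n+3, n+1). *)
Lemma moment_weight2 n : moment weight2 n = moment weight0 n.+1 / 3.
Proof.
rewrite /moment -RintegralZr//; last first.
  by apply: integrable_moment => u _; exact: continuous_weight0.
by apply: eq_Rintegral => u _; rewrite /weight2 exprS; ring.
Qed.

End substitution.

(** * Determinacy of the moment problem *)

Section step_approximation.
Context {R : realType}.
Implicit Types (x y q : R) (k n : nat).

Lemma bernoulli_onem n x : 0 <= x <= 1 -> 1 - n%:R * x <= (1 - x) ^+ n.
Proof.
move=> /andP[x0 x1]; elim: n => [|n IH]; first by rewrite mul0r subr0 expr0.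
have n0 : 0 <= n%:R :> R by [].
rewrite exprS -natr1; apply: (@le_trans _ _ ((1 - x) * (1 - n%:R * x))).
  nra.
by rewrite ler_wpM2l// subr_ge0.
Qed.

(** The induction step is (1-x)(1+(n+1)x) <= 1+nx. The result makes (1-x)^n small when nx is large,
    as Bernoulli's inequality keeps it near 1 when nx is small. *)
Lemma onem_exp_mul_le1 n x : 0 <= x <= 1 -> (1 - x) ^+ n * (1 + n%:R * x) <= 1.
Proof.
move=> /andP[x0 x1]; elim: n => [|n IH].
  by rewrite mul0r addr0 expr0 mulr1.
have n0 : 0 <= n%:R :> R by [].
have e0 : 0 <= (1 - x) ^+ n by rewrite exprn_ge0// subr_ge0.
rewrite exprSr -natr1; apply: le_trans IH; rewrite -mulrA ler_wpM2l//; nra.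
Qed.

(** With r = sqrt q, the term is (k r^k) r^k, and [onem_exp_mul_le1] at x = 1-r bounds k r^k by
    1/(1-r). A geometric sequence dominates. *)
Lemma cvg_natr_mul_expr q : 0 <= q < 1 -> (fun k => k%:R * q ^+ k) @ \oo --> 0.
Proof.
move=> /andP[q0 q1]; set r := Num.sqrt q.
have r0 : 0 <= r by exact: sqrtr_ge0.
have r1 : r < 1 by rewrite -sqrtr1 ltr_sqrt.
have qE : q = r * r by rewrite -expr2 sqr_sqrtr.
have d0 : 0 < 1 - r by rewrite subr_gt0.
apply: (@squeeze_cvgr _ _ _ _ (cst 0) (geometric (1 - r)^-1 r)).
- near=> k; rewrite mulr_ge0 ?exprn_ge0//= /geometric/= qE exprMn mulrA.
  rewrite ler_wpM2r ?exprn_ge0// -[leRHS]mulr1 ler_pdivlMl//.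
  have := @onem_exp_mul_le1 k (1 - r); rewrite subKr => h.
  apply: le_trans (h _); last by rewrite ltW//= gerBl.
  have -> : r ^+ k * (1 + k%:R * (1 - r)) = r ^+ k + (1 - r) * (k%:R * r ^+ k).
    by ring.
  by rewrite lerDr exprn_ge0.
- exact: cvg_cst.
- by apply: cvg_geometric; rewrite ger0_norm.
Unshelve. all: by end_near. Qed.

Definition step_approx k y : R := (1 - y ^+ k) ^+ (k * 2 ^ k).

Lemma step_approx_itv k y : 0 <= y <= 1 -> 0 <= step_approx k y <= 1.
Proof.
move=> /andP[y0 y1].
have yk : 0 <= y ^+ k <= 1 by rewrite exprn_ge0// exprn_ile1.
by rewrite exprn_ge0 ?exprn_ile1// ?subr_ge0 ?gerBl; case/andP: yk.
Qed.

(** The exponent of [step_approx] is chosen so that its product with y^k is k (2y)^k. Below 1/2 this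
    tends to 0 and Bernoulli's inequality forces the limit 1. From 1/2 on, with 1/2 included, it is
    at least k and the value is at most 1/(k+1). *)
Lemma cvg_step_approx y : 0 <= y <= 1 ->
  (fun k => step_approx k y) @ \oo --> ((y < 1 / 2)%R%:R : R).
Proof.
move=> y01; have /andP[y0 y1] := y01.
have yk k : 0 <= y ^+ k <= 1 by rewrite exprn_ge0// exprn_ile1.
have kE k : (k * 2 ^ k)%:R * y ^+ k = k%:R * (2 * y) ^+ k.
  by rewrite natrM natrX exprMn mulrA.
have [yh|yh] := ltP y (1 / 2).
- apply: (@squeeze_cvgr _ _ _ _ (fun k => 1 - k%:R * (2 * y) ^+ k) (cst 1)).
  + near=> k; have /andP[_ -> /=] := step_approx_itv k y01.
    by rewrite andbT -kE; exact: bernoulli_onem.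
  + rewrite -[X in _ --> X]subr0; apply: cvgB; first exact: cvg_cst.
    by apply: cvg_natr_mul_expr; apply/andP; split; lra.
  + exact: cvg_cst.
- apply: (@squeeze_cvgr _ _ _ _ (cst 0) (@harmonic R)).
  + near=> k; have /andP[s0 _] := step_approx_itv k y01; rewrite s0/=.
    rewrite -[leRHS]mul1r ler_pdivlMr//.
    apply: le_trans (onem_exp_mul_le1 (k * 2 ^ k) (yk k)).
    rewrite ler_wpM2l// kE -natr1 addrC lerD2l ler_peMr// exprn_ege1//; lra.
  + exact: cvg_cst.
  + exact: cvg_harmonic.
Unshelve. all: by end_near. Qed.

End step_approximation.

(** * Determinacy for measures with geometrically bounded even moments *)

Section moment_determinacy.
Context {R : realType}.
Implicit Types (P Q : probability (measurableTypeR R) R) (c M a : R).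

Let has_moments P :=
  forall n : nat, P.-integrable setT (fun x : R => (x ^+ n)%:E).

Lemma measurable_normr_ge c : measurable [set x : R | c <= `|x|].
Proof.
rewrite (_ : [set x | _] = `]-oo, - c]%classic `|` `[c, +oo[%classic).
  exact: measurableU.
by apply/seteqP; split => x /=;
  rewrite !in_itv/= andbT ler_normr lerNr orbC => /orP.
Qed.

(** Markov's inequality for x^(2n) bounds the mass of the tail by M (c/c')^(2n), which tends to
    0. *)
Lemma moment_tail_null P M c c' : 0 <= c < c' -> has_moments P ->
  (forall n, (\int[P]_x (x ^+ (2 * n))%:E <= (M * c ^+ (2 * n))%:E)%E) ->
  P [set x : R | c' <= `|x|] = 0%E.
Proof.
move=> /andP[c0 cc'] iP mP; set B := [set x : R | _].
have mB : measurable (B : set (measurableTypeR R)).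
  exact: measurable_normr_ge.
have c'0 : 0 < c' by exact: le_lt_trans cc'.
have fP : P B \is a fin_num by exact: fin_num_measure.
have q01 : `|(c / c') ^+ 2| < 1.
  have q0 : 0 <= c / c' by rewrite divr_ge0// ltW.
  by rewrite ger0_norm ?exprn_ge0// exprn_ilt1// ltr_pdivrMr// mul1r.
have bound n : fine (P B) <= geometric M ((c / c') ^+ 2) n.
  have e0 (x : R) : 0 <= x ^+ (2 * n) by rewrite exprM exprn_ge0// sqr_ge0.
  have : ((c' ^+ (2 * n))%:E * P B <= (M * c ^+ (2 * n))%:E)%E.
    apply: le_trans (mP n); rewrite -integral_cst//.
    apply: (@le_trans _ _ (\int[P]_(x in B) (x ^+ (2 * n))%:E)%E).
      apply: ge0_le_integral => //.
      - by move=> x _; rewrite lee_fin exprn_ge0// ltW.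
      - exact: measurable_funS (measurable_int _ (iP (2 * n))).
      - move=> x Bx; rewrite lee_fin -[leRHS]ger0_norm// normrX lerXn2r//.
          by rewrite nnegrE ltW.
    apply: ge0_subset_integral => //.
    + exact: (measurable_int _ (iP (2 * n))).
    + by move=> x _; rewrite lee_fin.
  rewrite -(fineK fP) -EFinM lee_fin => h.
  rewrite /geometric/= -exprM expr_div_n mulrA.
  by rewrite ler_pdivlMr ?exprn_gt0// mulrC.
have p0 : fine (P B) <= 0.
  apply: (ler_cvg_to (cvg_cst _) (cvg_geometric M q01)).
  by apply: nearW => n; exact: bound.
apply/eqP; rewrite -(fineK fP) eqe eq_le p0 /=.
exact/fine_ge0/measure_ge0.
Qed.

Lemma integral_horner P (p : {poly R}) : has_moments P ->
  P.-integrable setT (fun x : R => (p.[x])%:E) /\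
  (\int[P]_x (p.[x])%:E =
   \sum_(i < size p) (p`_i)%:E * \int[P]_x (x ^+ i)%:E)%E.
Proof.
move=> iP.
have pE (x : R) : (p.[x])%:E = (\sum_(i < size p) (p`_i)%:E * (x ^+ i)%:E)%E.
  by rewrite horner_coef -sumEFin; apply: eq_bigr.
have ip (i : 'I_(size p)) :
    P.-integrable setT (fun x : R => (p`_i)%:E * (x ^+ i)%:E)%E.
  exact: integrableZl.
under eq_fun do rewrite pE; split; first exact: integrable_sum.
rewrite integral_sum//; apply: eq_bigr => i _.
by rewrite integralZl.
Qed.

(** Makes the integrals of the approximations depend on the moments alone. *)
Lemma step_approx_horner k (p : {poly R}) :
  exists q : {poly R}, forall x, q.[x] = step_approx k p.[x].
Proof.
exists ((1 - p ^+ k) ^+ (k * 2 ^ k)) => x.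
by rewrite /step_approx !(hornerE, horner_exp).
Qed.

(** The affine map [l] sends a to 1/2 and, since |x - a| <= c + |a| there, sends [-c, c] into
    [0, 1]. Almost everywhere the approximations thus lie in [0, 1] and converge to the indicator of
    the ray, so dominated convergence applies with bound 1. *)
Lemma cvg_integral_step_approx P c a
    (l := fun x : R => 1 / 2 + (x - a) / (2 * (c + `|a|))) :
  0 < c -> P [set x : R | c <= `|x|] = 0%E ->
  (\int[P]_x (step_approx k (l x))%:E)%E @[k --> \oo] --> P `]-oo, a[%classic.
Proof.
move=> c0 Pc.
have L0 : 0 < 2 * (c + `|a|) by rewrite mulr_gt0// ltr_pwDl.
have ml : measurable_fun [set: R] l.
  apply: measurable_funD => //; apply: measurable_funM => //.
  exact: measurable_funB.
have mS k : measurable_fun [set: R] (fun x => step_approx k (l x)).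
  apply: measurable_funX; apply: measurable_funB => //.
  exact: measurable_funX.
have aeP : \forall x \ae P, 0 <= l x <= 1.
  exists [set x : R | c <= `|x|].
  split; [exact: measurable_normr_ge|exact: Pc|].
  move=> x /= lx; rewrite leNgt; apply/negP => xc; apply: lx.
  have : `|x - a| <= c + `|a|.
    by apply: le_trans (ler_normB _ _) _; rewrite lerD2r ltW.
  set d := c + `|a|; move=> xad; have d0 : 0 < d by rewrite ltr_pwDl.
  have : `|(x - a) / (2 * d)| <= 1 / 2.
    by rewrite normrM normfV [`|2 * d|]gtr0_norm// ler_pdivrMr//; lra.
  by rewrite ler_norml /l -/d => /andP[? ?]; apply/andP; split; lra.
have -> : P `]-oo, a[%classic = (\int[P]_x (\1_`]-oo, a[%classic x)%:E)%E.
  by rewrite integral_indic// setIT.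
have lE x : (l x < 1 / 2) = (x < a).
  by rewrite /l -ltrBrDl subrr pmulr_llt0 ?invr_gt0// subr_lt0.
have FP := ae_filter_ringOfSetsType P.
have [] := @dominated_convergence _ _ _ P setT measurableT
  (fun k x => (step_approx k (l x))%:E) (fun x => (\1_`]-oo, a[%classic x)%:E)
  (cst 1%E).
- by move=> k; apply/measurable_EFinP; exact: mS.
- by apply/measurable_EFinP.
- apply: (filterS _ aeP) => x lx _ /=; apply: cvg_EFin; first exact: nearW.
  rewrite indicE mem_setE in_itv/= -lE; exact: cvg_step_approx.
- exact: finite_measure_integrable_cst.
- apply: (filterS _ aeP) => x lx k _ /=.
  by have /andP[s0 s1] := step_approx_itv k lx; rewrite ger0_norm// lee_fin.
by [].
Qed.

(** The bound is asked of [P] only, because [Q] has the same even moments. Polynomial approximation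
    then identifies the masses of all rays ]-oo, a[. *)
Theorem moment_determinacy P Q M c : 0 <= c -> has_moments P -> has_moments Q ->
  (forall n, (\int[P]_x (x ^+ n)%:E = \int[Q]_x (x ^+ n)%:E)%E) ->
  (forall n, (\int[P]_x (x ^+ (2 * n))%:E <= (M * c ^+ (2 * n))%:E)%E) ->
  forall A, measurable A -> P A = Q A.
Proof.
move=> c0 iP iQ PQ PM.
(* The tail estimate needs a radius strictly larger than [c]. *)
have cc : 0 <= c < c + 1 by rewrite c0 ltrDl ltr01.
have c1 : 0 < c + 1 by rewrite ltr_wpDl.
have P0 := moment_tail_null cc iP PM.
have Q0 : Q [set x : R | c + 1 <= `|x|] = 0%E.
  by apply: (moment_tail_null cc iQ) => n; rewrite -PQ; exact: PM.
have PQE (p : {poly R}) : (\int[P]_x (p.[x])%:E = \int[Q]_x (p.[x])%:E)%E.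
  rewrite (integral_horner p iP).2 (integral_horner p iQ).2.
  by apply: eq_bigr => i _; rewrite PQ.
have PQray a : P `]-oo, a[%classic = Q `]-oo, a[%classic.
  pose p : {poly R} := (1 / 2)%:P + ('X - a%:P) * ((2 * (c + 1 + `|a|))^-1)%:P.
  have pE x : p.[x] = 1 / 2 + (x - a) / (2 * (c + 1 + `|a|)).
    by rewrite /p !hornerE.
  have cQ := @cvg_integral_step_approx _ _ a c1 Q0.
  have cP := @cvg_integral_step_approx _ _ a c1 P0.
  suff QP : (fun k => \int[Q]_x
        (step_approx k (1 / 2 + (x - a) / (2 * (c + 1 + `|a|))))%:E)%E =
      (fun k => \int[P]_x
        (step_approx k (1 / 2 + (x - a) / (2 * (c + 1 + `|a|))))%:E)%E.
    by rewrite QP in cQ; exact: (cvg_unique _ cP cQ).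
  apply/funext => k; have [q qE] := step_approx_horner k p.
  transitivity (\int[Q]_x (q.[x])%:E)%E.
    by apply: eq_integral => x _; rewrite qE pE.
  by rewrite -PQE; apply: eq_integral => x _; rewrite qE pE.
(* Open left rays are stable under intersection and generate the Borel sets, and the rays ]-oo, n[
   exhaust the line with finite mass. *)
apply: (@measure_unique _ R (measurableTypeR R) (@RGenInftyO.G R)
  (fun n => `]-oo, n%:R[%classic) _ _ _ _ P Q).
- exact: RGenInftyO.measurableE.
- move=> _ _ [x ->] [y ->]; exists (Num.min x y).
  by apply/seteqP; split => z /=; rewrite !in_itv/= lt_min => /andP.
- by move=> n; exists n%:R.
- apply/seteqP; split => // x _; exists (Num.bound `|x : R|) => //=.
  by rewrite in_itv/=; apply: le_lt_trans (ler_norm x) _; exact: archi_boundP.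
- by move=> _ [x ->]; exact: PQray.
- by move=> n; rewrite ltey_eq fin_num_measure.
Qed.

End moment_determinacy.

(** * Measures with a density *)

Section density.
Context {R : realType}.
Local Notation leb := (@lebesgue_measure R).
Implicit Types (f : R -> R) (P : probability (measurableTypeR R) R).

Lemma density_probability f : measurable_fun [set: R] f ->
  (forall x, 0 <= f x) -> (\int[leb]_x (f x)%:E = 1)%E ->
  exists P, forall A, measurable A -> P A = (\int[leb]_(x in A) (f x)%:E)%E.
Proof.
move=> mf f0 f1.
pose F (A : set (measurableTypeR R)) := (\int[leb]_(x in A) (f x)%:E)%E.
have F0 : F set0 = 0%E by rewrite /F integral_set0.
have F_ge0 A : (0 <= F A)%E by apply: integral_ge0 => x _; rewrite lee_fin.
have Fsigma : semi_sigma_additive F.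
  move=> /= A mA tA mUA; rewrite /F; apply: cvg_toP.
    apply: ereal_nondecreasing_is_cvgn => m n mn.
    by apply: lee_sum_nneg_natr => // k _ _; exact: F_ge0.
  rewrite ge0_integral_bigcup//=.
  - exact/measurable_EFinP/measurable_funTS.
  - by move=> x _; rewrite lee_fin.
pose Fm := isMeasure.Build _ _ _ F F0 F_ge0 Fsigma.
pose FM : {measure set (measurableTypeR R) -> \bar R} := HB.pack F Fm.
pose Fp := Measure_isProbability.Build _ _ _ FM f1.
by exists (HB.pack F Fm Fp : probability (measurableTypeR R) R).
Qed.

(** [P] is dominated by Lebesgue measure, and its Radon-Nikodym derivative has the same integrals as
    [f] over measurable sets, hence equals [f] almost everywhere. The change of variables for that
    derivative carries over to [f]. *)
Lemma integral_density f P (g : R -> R) : measurable_fun [set: R] f ->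
  (forall x, 0 <= f x) ->
  (forall A, measurable A -> P A = (\int[leb]_(x in A) (f x)%:E)%E) ->
  measurable_fun [set: R] g ->
  leb.-integrable setT (fun x => (g x * f x)%:E) ->
  P.-integrable setT (fun x : R => (g x)%:E) /\
  (\int[P]_x (g x)%:E = \int[leb]_x (g x * f x)%:E)%E.
Proof.
move=> mf f0 Pf mg igf.
have Pleb : P `<< leb.
  apply/null_content_dominatesP => A mA A0; rewrite Pf//.
  by apply: null_set_integral => //; exact/measurable_EFinP/measurable_funTS.
pose h := Radon_Nikodym_SigmaFinite.f P leb.
have mh : measurable_fun [set: R] h.
  exact: measurable_int (Radon_Nikodym_SigmaFinite.f_integrable Pleb).
have mfE : measurable_fun [set: R] (EFin \o f) by exact/measurable_EFinP.
have hf : ae_eq leb setT h (EFin \o f).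
  apply: integral_ae_eq => //.
    exact: Radon_Nikodym_SigmaFinite.f_integrable.
  move=> E _ mE; rewrite -(Radon_Nikodym_SigmaFinite.f_integral Pleb mE).
  exact: Pf.
(* Integrability comes first, from the formula for the nonnegative function |g|. The formula for the
   signed [g] relies on it. *)
have iPg : P.-integrable setT (fun x : R => (g x)%:E).
  apply/integrableP; split; first exact/measurable_EFinP.
  have mg' : measurable_fun [set: R] (fun x => `|(g x)%:E|%E).
    by apply: measurableT_comp => //; exact/measurable_EFinP.
  rewrite -(Radon_Nikodym_SigmaFinite.change_of_variables Pleb)//.
  have /integrableP[_] := igf; apply: le_lt_trans.
  rewrite le_eqVlt; apply/orP; left; apply/eqP.
  apply: ae_eq_integral => //.
  - exact: emeasurable_funM.
  - apply: measurableT_comp => //.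
    by apply/measurable_EFinP; exact: measurable_funM.
  - have FF := ae_filter_ringOfSetsType leb.
    apply: (filterS _ hf) => x hx _.
    transitivity (`|(g x)%:E| * (f x)%:E)%E.
      by congr (_ * _)%E; exact: hx.
    by rewrite -EFinM/= normrM (ger0_norm (f0 x)).
split => //.
rewrite -(Radon_Nikodym_change_of_variables Pleb)//.
apply: ae_eq_integral => //.
- apply: emeasurable_funM; first exact/measurable_EFinP.
  exact/measurable_int/Radon_Nikodym_integrable.
- by apply/measurable_EFinP; exact: measurable_funM.
- have FF := ae_filter_ringOfSetsType leb.
  have hRN := ae_eq_Radon_Nikodym_SigmaFinite Pleb measurableT.
  apply: (filterS2 _ _ hf hRN) => x hx hRNx _.
  rewrite EFinM; congr (_ * _)%E.
  exact: (etrans (esym (hRNx I)) (hx I)).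
Qed.

End density.
(** * Change of variables *)

Section change_of_variables.
Context {R : realType}.
Local Notation leb := (@lebesgue_measure R).
Local Notation X := (@cubic_map R).
Implicit Types u x : R.

Let dX u : R := 81 * u ^+ 2 * (1 - u ^+ 3) / (1 + u ^+ 3) ^+ 3.

Lemma cubic_map0 : X 0 = 0.
Proof. by rewrite /cubic_map expr0n/= mulr0 mul0r. Qed.

Lemma cubic_map1 : X 1 = 27 / 4.
Proof. by rewrite /cubic_map !expr1n; field. Qed.

Lemma cubic_map_lt u v : 0 <= u -> u < v -> v <= 1 -> X u < X v.
Proof.
move=> u0 uv v1; have v0 : 0 <= v by exact/ltW/(le_lt_trans u0).
have : u ^+ 3 < v ^+ 3 by rewrite ltrXn2r.
have : v ^+ 3 <= 1 by rewrite exprn_ile1.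
have : 0 <= u ^+ 3 by rewrite exprn_ge0.
rewrite /cubic_map; move: (u ^+ 3) (v ^+ 3) => a b a0 b1 ab.
have d0 : 0 < 1 + a by lra.
have d1 : 0 < 1 + b by lra.
rewrite -!mulrA ltr_pM2l// ltr_pdivrMr ?exprn_gt0//.
rewrite mulrAC ltr_pdivlMr ?exprn_gt0//.
(* The difference factors as (b-a)(1-ab), which is positive because 0 <= a < b <= 1. *)
have -> : a * (1 + b) ^+ 2 = b * (1 + a) ^+ 2 - (b - a) * (1 - a * b) by ring.
by rewrite ltrBlDr ltrDl mulr_gt0 ?subr_gt0//; nra.
Qed.

Lemma cubic_map_le u v : 0 <= u -> u <= v -> v <= 1 -> X u <= X v.
Proof.
move=> u0 uv v1; have [->//|neq] := eqVneq u v.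
by apply/ltW/cubic_map_lt => //; rewrite lt_neqAle neq.
Qed.

Lemma cubic_map_derive1 u : 0 <= u -> (derive1 X) u = dX u.
Proof.
by move=> u0; rewrite derive1E; have [_ ->] := is_derive_cubic_map u0.
Qed.

(** The formula [dX] is established on the nonnegative axis, so it describes the derivative on a
    whole neighbourhood only at positive points. *)
Lemma continuous_cubic_map_derive1 u : 0 < u -> {for u, continuous (derive1 X)}.
Proof.
move=> u0; have /lt0r_neq0 d0 := cube_add1_gt0 (ltW u0).
have cdX : {for u, continuous dX}.
  notypeclasses refine (is_derive_continuous _); rewrite /dX.
  by repeat derive_step; rewrite expf_neq0.
rewrite /prop_for /continuous_at cubic_map_derive1 ?ltW//.
apply: cvg_trans cdX; apply: near_eq_cvg.
near=> t; rewrite cubic_map_derive1//.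
by near: t; apply: filterS (lt_nbhsr u0) => y /ltW.
Unshelve. all: by end_near. Qed.

(** Compact subintervals of ]0, 1[ come first: the densities to be integrated blow up at 27/4, and
    two of the three also at 0. *)
Lemma integral_cubic_map_cc (h : R -> R) a b : 0 < a -> a <= b -> b < 1 ->
  (forall x, 0 < x < 27 / 4 -> {for x, continuous h}) ->
  (\int[leb]_(x in `[X a, X b]) (h x)%:E =
   \int[leb]_(u in `[a, b]) (h (X u) * dX u)%:E)%E.
Proof.
move=> a0 ab b1 ch.
have cX u : a <= u -> {for u, continuous X}.
  by move=> au; apply: continuous_cubic_map; rewrite (le_trans _ au)// ltW.
rewrite integration_by_substitution_increasing//.
- apply: eq_integral => u /[!inE]/= /[!in_itv]/= /andP[au _].
  by rewrite -cubic_map_derive1// (le_trans _ au)// ltW.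
- move=> u v; rewrite !in_itv/= => /andP[au _] /andP[_ vb] uv.
  apply: cubic_map_lt => //; first by rewrite (le_trans _ au)// ltW.
  exact/ltW/(le_lt_trans vb).
- move=> u; rewrite in_itv/= => /andP[au _].
  by apply: continuous_cubic_map_derive1; exact: lt_trans au.
- apply: (cvgP (derive1 X a)); apply: cvg_at_right_filter.
  exact: continuous_cubic_map_derive1.
- apply: (cvgP (derive1 X b)); apply: cvg_at_left_filter.
  by apply: continuous_cubic_map_derive1; exact: lt_le_trans ab.
- split.
  + move=> u; rewrite in_itv/= => /andP[au _].
    by have [] := @is_derive_cubic_map _ u _; rewrite ?(ltW (lt_trans a0 au)).
  + by apply: cvg_at_right_filter; exact: cX.
  + by apply: cvg_at_left_filter; exact: cX.
- apply: continuous_in_subspaceT => x /[!inE]/= /[!in_itv]/= /andP[ax xb].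
  apply: ch; rewrite (lt_le_trans _ ax)/= ?(le_lt_trans xb)//.
    by rewrite -cubic_map1 cubic_map_lt// (le_trans _ ab)// ltW.
  by rewrite -cubic_map0 cubic_map_lt// (le_trans ab)// ltW.
Qed.

(** The shift by 3 keeps [lo k] strictly below 1/2 already at k = 0, so that [[lo k, 1 - lo k]] is a
    proper interval. *)
Let lo (k : nat) : R := (k.+3%:R)^-1.

Lemma lo_itv k : 0 < lo k < 1 / 2.
Proof.
rewrite /lo invr_gt0 ltr0n/= mul1r ltf_pV2 ?posrE ?ltr0n//.
by rewrite ltr_nat.
Qed.

Lemma cvg_lo : lo @ \oo --> 0.
Proof.
have := @cvg_harmonic R; rewrite -(cvg_shiftn 2); apply: cvg_trans.
by apply: near_eq_cvg; near=> k; rewrite /lo/harmonic/= addn2.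
Unshelve. all: by end_near. Qed.

Lemma lo_le m n : (m <= n)%N -> lo n <= lo m.
Proof. by move=> mn; rewrite /lo lef_pV2 ?posrE ?ltr0n// ler_nat. Qed.

Lemma bigcup_lo : \bigcup_k `[lo k, 1 - lo k]%classic = `]0, 1[%classic.
Proof.
apply/seteqP; split => x /=.
  move=> [k _]; rewrite /= !in_itv/= => /andP[h1 h2].
  by have /andP[l0 l1] := lo_itv k; apply/andP; split; lra.
rewrite in_itv/= => /andP[x0 x1].
have H1 : \forall k \near \oo, lo k < x by exact: (cvgr_lt _ cvg_lo).
have H2 : \forall k \near \oo, lo k < 1 - x.
  by apply: (cvgr_lt _ cvg_lo); rewrite subr_gt0.
have [k [k1 k2]] := filter_ex (filterI H1 H2); exists k => //=.
by rewrite in_itv/=; apply/andP; split; lra.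
Qed.

Lemma bigcup_cubic_map_lo :
  \bigcup_k `[X (lo k), X (1 - lo k)]%classic = `]0, 27 / 4[%classic.
Proof.
apply/seteqP; split => x /=.
  move=> [k _]; rewrite /= !in_itv/= => /andP[h1 h2].
  have /andP[l0 l1] := lo_itv k; apply/andP; split.
    by apply: lt_le_trans h1; rewrite -cubic_map0 cubic_map_lt//; lra.
  by apply: le_lt_trans h2 _; rewrite -cubic_map1 cubic_map_lt//; lra.
rewrite in_itv/= => /andP[x0 x1].
have H1 : \forall k \near \oo, X (lo k) < x.
  apply: (cvgr_lt 0) => //; rewrite -cubic_map0.
  exact: (continuous_cvg _ (continuous_cubic_map (lexx 0)) cvg_lo).
have H2 : \forall k \near \oo, x < X (1 - lo k).
  apply: (cvgr_gt (27 / 4)) => //; rewrite -cubic_map1.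
  apply: (continuous_cvg _ (continuous_cubic_map ler01)).
  by rewrite -[X in _ --> X]subr0; apply: cvgB cvg_lo; exact: cvg_cst.
have [k [k1 k2]] := filter_ex (filterI H1 H2); exists k => //=.
by rewrite in_itv/=; apply/andP; split; exact/ltW.
Qed.

(** Monotone convergence along the exhausting intervals on both sides. The function [g] extends the
    transformed integrand continuously to [0, 1], and the two added endpoints do not change the
    integral. *)
Lemma integral_cubic_map (h g : R -> R) :
  (forall x, 0 < x < 27 / 4 -> 0 <= h x) ->
  (forall x, 0 < x < 27 / 4 -> {for x, continuous h}) ->
  (forall u, 0 < u < 1 -> h (X u) * dX u = g u) ->
  (forall u, 0 <= u -> {for u, continuous g}) ->
  (\int[leb]_(x in `]0%R, (27 / 4)%R[) (h x)%:E =
   \int[leb]_(u in `[0%R, 1%R]) (g u)%:E)%E.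
Proof.
move=> h0 ch hg cg.
have lo2 k : lo k <= 1 - lo k by have := lo_itv k; lra.
have itvX k x : x \in `[X (lo k), X (1 - lo k)] -> 0 < x < 27 / 4.
  move=> xk; have : (\bigcup_k `[X (lo k), X (1 - lo k)]%classic) x by exists k.
  by rewrite bigcup_cubic_map_lo /= in_itv.
have itvU k u : u \in `[lo k, 1 - lo k] -> 0 < u < 1.
  move=> uk; have : (\bigcup_k `[lo k, 1 - lo k]%classic) u by exists k.
  by rewrite bigcup_lo /= in_itv.
have g0 u : 0 < u < 1 -> 0 <= g u.
  move=> u01; have /andP[u0 u1] := u01; rewrite -hg//; apply: mulr_ge0.
    apply: h0; rewrite -cubic_map0 -cubic_map1.
    by rewrite !cubic_map_lt//; exact/ltW.
  have d0 := cube_add1_gt0 (ltW u0).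
  have u3 : u ^+ 3 <= 1 by rewrite exprn_ile1// ltW.
  apply: divr_ge0; last exact/exprn_ge0/ltW.
  apply: mulr_ge0; last by rewrite subr_ge0.
  by rewrite mulr_ge0// sqr_ge0.
have mh k : measurable_fun `[X (lo k), X (1 - lo k)]%classic h.
  apply: subspace_continuous_measurable_fun => //.
  by apply: continuous_in_subspaceT => x /[!inE]/= /itvX; exact: ch.
have mg k : measurable_fun `[lo k, 1 - lo k]%classic g.
  apply: subspace_continuous_measurable_fun => //.
  apply: continuous_in_subspaceT => x /[!inE]/= /itvU/andP[/ltW x0 _].
  exact: cg.
have ch' :
    (\int[leb]_(x in `[X (lo k), X (1 - lo k)]) (h x)%:E)%E @[k --> \oo] -->
    (\int[leb]_(x in `]0%R, (27 / 4)%R[) (h x)%:E)%E.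
  rewrite -bigcup_cubic_map_lo; apply: ge0_nondecreasing_set_cvg_integral => //.
  - move=> m n mn; apply/subsetPset => x /=; rewrite !in_itv/= => /andP[h1 h2].
    have /andP[m0 m1] := lo_itv m; have /andP[n0 n1] := lo_itv n.
    have nm := lo_le mn; apply/andP; split.
      by apply: le_trans h1; apply: cubic_map_le => //; lra.
    by apply: le_trans h2 _; apply: cubic_map_le => //; lra.
  - by move=> k; apply/measurable_EFinP; exact: mh.
  - by move=> k x /itvX xk; rewrite lee_fin h0.
have cg' : (\int[leb]_(u in `[lo k, (1 - lo k)%R]) (g u)%:E)%E @[k --> \oo] -->
    (\int[leb]_(u in `]0%R, 1%R[) (g u)%:E)%E.
  rewrite -bigcup_lo; apply: ge0_nondecreasing_set_cvg_integral => //.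
  - move=> m n mn; apply/subsetPset => x /=; rewrite !in_itv/= => /andP[h1 h2].
    by have := lo_le mn => nm; apply/andP; split; lra.
  - by move=> k; apply/measurable_EFinP; exact: mg.
  - by move=> k u /itvU uk; rewrite lee_fin g0.
rewrite [RHS]integral_itv_bndoo; last first.
  apply/measurable_EFinP; apply: subspace_continuous_measurable_fun => //.
  apply: continuous_in_subspaceT => u /[!inE]/= /[!in_itv]/= /andP[/ltW u0 _].
  exact: cg.
suff hgE : (fun k => \int[leb]_(x in `[X (lo k), X (1 - lo k)]) (h x)%:E)%E =
    (fun k => \int[leb]_(u in `[lo k, (1 - lo k)%R]) (g u)%:E)%E.
  by rewrite hgE in ch'; exact: (cvg_unique _ ch' cg').
apply/funext => k; have /andP[l0 l1] := lo_itv k.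
rewrite integral_cubic_map_cc//; last by lra.
by apply: eq_integral => u /[!inE]/= /itvU u01; rewrite hg.
Qed.

End change_of_variables.

(** * Binomial coefficients *)

Section binomial_numbers.
Context {R : realType}.

Lemma gbinom_natr (m n : nat) : (n <= m)%N -> gbinom (m%:R : R) n = 'C(m, n)%:R.
Proof.
move=> nm; rewrite /gbinom; apply: (mulIf (_ : n`!%:R != 0)).
  by rewrite pnatr_eq0 -lt0n fact_gt0.
rewrite divfK ?pnatr_eq0 -?lt0n ?fact_gt0// -natrM bin_ffact ffact_prod.
rewrite natr_prod; apply: eq_bigr => i _.
by rewrite natrB// (leq_trans _ nm)// ltnW.
Qed.

Lemma gbinom3_natr (r n : nat) :
  gbinom (n%:R * 3 + r%:R : R) n = 'C(n * 3 + r, n)%:R.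
Proof.
rewrite -natrM -natrD gbinom_natr// (leq_trans _ (leq_addr _ _))//.
by rewrite leq_pmulr.
Qed.

(** A form free of division and of natural subtraction, from which the three relations below are
    obtained by cancelling factorials. *)
Lemma bin3_fact (r n : nat) :
  'C(n * 3 + r, n)%:R * (n`!%:R * (2 * n + r)`!%:R) = (n * 3 + r)`!%:R :> R.
Proof.
rewrite -!natrM -(@bin_fact (n * 3 + r) n); last by lia.
by congr (_ * (_ * _`!))%N%:R; lia.
Qed.

Let bin3 (r n : nat) : R := 'C(n * 3 + r, n)%:R.

Let natr_fact_neq0 n : n`!%:R != 0 :> R.
Proof. by rewrite pnatr_eq0 -lt0n fact_gt0. Qed.

(** This relation and the next two mirror [moment_weight0S], [moment_weight1] and
    [moment_weight2]. *)
Lemma bin3_0S n : 2 * (n%:R + 1) * (2 * n%:R + 1) * bin3 0 n.+1 =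
  3 * (3 * n%:R + 1) * (3 * n%:R + 2) * bin3 0 n.
Proof.
have := bin3_fact 0 n.+1; have := bin3_fact 0 n.
rewrite -/(bin3 0 n) -/(bin3 0 n.+1).
have -> : (n.+1 * 3 + 0 = (n * 3 + 0).+3)%N by lia.
have -> : (2 * n.+1 + 0 = (2 * n + 0).+2)%N by lia.
rewrite !factS !addn0 => e; rewrite !natrM -e -!natr1 !natrM.
have x0 := natr_fact_neq0 n; have y0 := natr_fact_neq0 (2 * n).
have n0 : 0 <= n%:R :> R by [].
have n1 : n%:R + 1 != 0 :> R by apply/lt0r_neq0; lra.
move: (bin3 0 n) (bin3 0 n.+1) (n`!%:R) ((2 * n)`!%:R) (n%:R) x0 y0 n1 {e n0}.
move=> a b x y t x0 y0 t0 h.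
apply: (mulIf (mulf_neq0 t0 (mulf_neq0 x0 y0))).
by transitivity (b * ((t + 1) * x * ((2 * t + 1 + 1) * ((2 * t + 1) * y))));
  [ring | rewrite h; ring].
Qed.

Lemma bin3_1 n : (2 * n%:R + 1) * bin3 1 n = (3 * n%:R + 1) * bin3 0 n.
Proof.
have := bin3_fact 1 n; have := bin3_fact 0 n.
rewrite -/(bin3 0 n) -/(bin3 1 n) !addn1 !addn0 !factS => e.
rewrite !natrM -e -!natr1 !natrM.
have x0 := natr_fact_neq0 n; have y0 := natr_fact_neq0 (2 * n).
move: (bin3 0 n) (bin3 1 n) (n`!%:R) ((2 * n)`!%:R) (n%:R) x0 y0 {e}.
move=> a b x y t x0 y0 h.
apply: (mulIf (mulf_neq0 x0 y0)).
by transitivity (b * (x * ((2 * t + 1) * y))); [ring | rewrite h; ring].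
Qed.

Lemma bin3_2 n : 3 * bin3 2 n = bin3 0 n.+1.
Proof.
have := bin3_fact 0 n.+1; have := bin3_fact 2 n.
rewrite -/(bin3 2 n) -/(bin3 0 n.+1).
have -> : (n.+1 * 3 + 0 = (n * 3 + 2).+1)%N by lia.
have -> : (2 * n.+1 + 0 = 2 * n + 2)%N by lia.
rewrite !factS => e; rewrite !natrM -e -!natr1 natrD !natrM.
have x0 := natr_fact_neq0 n; have y0 := natr_fact_neq0 (2 * n + 2).
have n0 : 0 <= n%:R :> R by [].
have n1 : n%:R + 1 != 0 :> R by apply/lt0r_neq0; lra.
move: (bin3 2 n) (bin3 0 n.+1) (n`!%:R) ((2 * n + 2)`!%:R) (n%:R)
  x0 y0 n1 {e n0}.
move=> a b x y t x0 y0 t0 h.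
apply: (mulIf (mulf_neq0 t0 (mulf_neq0 x0 y0))).
by transitivity (b * ((t + 1) * x * y)); [rewrite h | ]; ring.
Qed.

End binomial_numbers.

(** * Moments of the weights as binomial coefficients *)

Section binomial_moments.
Context {R : realType}.
(** Both sides equal 1 at n = 0 and satisfy the same first-order recurrence. *)
Lemma moment_weight0_gbinom n :
  moment weight0 n = gbinom (n%:R * 3 + 0 : R) n.
Proof.
rewrite (gbinom3_natr 0); elim: n => [|n IH].
  rewrite bin0 /moment -[RHS]Rintegral_weight0.
  by apply: eq_Rintegral => u _; rewrite mul1r.
have c0 : 2 * (n%:R + 1) * (2 * n%:R + 1) != 0 :> R.
  by apply/lt0r_neq0; have := ler0n R n; nra.
by apply: (mulfI c0); rewrite moment_weight0S bin3_0S IH.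
Qed.

Lemma moment_weight1_gbinom n :
  moment weight1 n = gbinom (n%:R * 3 + 1 : R) n.
Proof.
have c0 : 2 * n%:R + 1 != 0 :> R by apply/lt0r_neq0; have := ler0n R n; lra.
apply: (mulfI c0); rewrite moment_weight1 moment_weight0_gbinom.
by rewrite (gbinom3_natr 0) (gbinom3_natr 1) bin3_1.
Qed.

Lemma moment_weight2_gbinom n :
  moment weight2 n = gbinom (n%:R * 3 + 2 : R) n.
Proof.
rewrite moment_weight2 moment_weight0_gbinom (gbinom3_natr 0) (gbinom3_natr 2).
by rewrite -bin3_2; field.
Qed.

End binomial_moments.

(** * The explicit densities *)

Section explicit_density.
Context {R : realType}.
Local Notation X := (@cubic_map R).
Implicit Types (k a b x u : R).

(** The common shape of the three claimed densities, so that nonnegativity and continuity are proved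
    once. *)
Definition raney_density k a b b' x : R :=
  let z := 4 * x / 27 in
  let s := 1 + Num.sqrt (1 - z) in
  let d := pi * Num.sqrt (3 * (1 - z)) in
  s `^ a / (k * d) * z `^ b + s `^ (- a) / (k * d) * z `^ b'.

(** Valid at every real x, because real powers and square roots are nonnegative at their default
    values too. *)
Lemma raney_density_ge0 k a b b' x : 0 <= k -> 0 <= raney_density k a b b' x.
Proof.
move=> k0; rewrite /raney_density.
have d0 : 0 <= pi * Num.sqrt (3 * (1 - 4 * x / 27)) :> R.
  by rewrite mulr_ge0 ?sqrtr_ge0 ?pi_ge0.
by rewrite addr_ge0// !mulr_ge0 ?powR_ge0// invr_ge0 mulr_ge0.
Qed.

Lemma continuous_powR_base a x : 0 < x -> {for x, continuous (fun y => y `^ a)}.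
Proof. by move=> x0; exact: is_derive_continuous (is_derive1_powR a x0). Qed.

Lemma continuous_raney_density k a b b' x : k != 0 -> 0 < x < 27 / 4 ->
  {for x, continuous (raney_density k a b b')}.
Proof.
move=> k0 /andP[x0 x1].
pose z x : R := 4 * x / 27.
have z0 : 0 < z x by rewrite /z; lra.
have z1 : 0 < 1 - z x by rewrite /z; lra.
have cz : {for x, continuous z}.
  notypeclasses refine (is_derive_continuous _); rewrite /z.
  by repeat derive_step.
have c1z : {for x, continuous (fun y => 1 - z y)}.
  by apply: continuousB => //; exact: cst_continuous.
pose s x : R := 1 + Num.sqrt (1 - z x).
have cs : {for x, continuous s}.
  apply: continuousD; first exact: cst_continuous.
  apply: (@continuous_comp _ _ _ (fun y => 1 - z y) Num.sqrt) => //.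
  exact: sqrt_continuous.
pose d x : R := k * (pi * Num.sqrt (3 * (1 - z x))).
have cd : {for x, continuous d}.
  do 2 (apply: continuousM; first exact: cst_continuous).
  apply: (@continuous_comp _ _ _ (fun y => 3 * (1 - z y)) Num.sqrt).
    by apply: continuousM => //; exact: cst_continuous.
  exact: sqrt_continuous.
have d0 : d x != 0.
  by rewrite !mulf_neq0// ?gt_eqF ?pi_gt0// sqrtr_gt0 mulr_gt0.
have s0 : 0 < s x by rewrite ltr_pwDl// sqrtr_ge0.
have cpow (f : R -> R) c : 0 < f x -> {for x, continuous f} ->
    {for x, continuous (fun y => f y `^ c)}.
  move=> f0 cf; apply: (@continuous_comp _ _ _ f (fun y => y `^ c)) => //.
  exact: continuous_powR_base.
have cV : {for x, continuous (fun y => (d y)^-1)} by exact: continuousV.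
have cterm c e : {for x, continuous (fun y => s y `^ c / d y * z y `^ e)}.
  apply: (@continuousM _ _ (fun y => s y `^ c / d y)); last exact: cpow.
  by apply: (@continuousM _ _ (fun y => s y `^ c)) => //; exact: cpow.
exact: continuousD (cterm a b) (cterm (- a) b').
Qed.

Lemma powR_cube_third x : 0 <= x -> (x ^+ 3) `^ (1 / 3) = x.
Proof. by move=> x0; rewrite -powR_mulrn// -powRrM mul1r mulfV// powRr1. Qed.

Lemma powR_cube_two_thirds x : 0 <= x -> (x ^+ 3) `^ (2 / 3) = x ^+ 2.
Proof.
by move=> x0; rewrite -powR_mulrn// -powRrM mulrC divfK// powR_mulrn.
Qed.

(** The radical disappears because 1 - 4 X(u)/27 is the square of (1-u^3)/(1+u^3). Writing
    [Num.sqrt 3] as [3 / Num.sqrt 3] in a denominator puts the root in the numerator, as in the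
    weights. *)
Lemma cubic_map_substitution u : 0 < u < 1 ->
  exists c : R, [/\ 0 < c, c ^+ 3 = 2 / (1 + u ^+ 3),
    4 * X u / 27 = (c ^+ 2 * u) ^+ 3,
    1 + Num.sqrt (1 - 4 * X u / 27) = c ^+ 3 &
    Num.sqrt (3 * (1 - 4 * X u / 27)) =
      3 / Num.sqrt 3 * ((1 - u ^+ 3) / (1 + u ^+ 3))].
Proof.
move=> /andP[u0 u1]; have t0 := cube_add1_gt0 (ltW u0).
have t1 : 0 < 1 - u ^+ 3 by rewrite subr_gt0 exprn_ilt1// ltW.
have c0 : 0 <= 2 / (1 + u ^+ 3) by rewrite divr_ge0// ltW.
pose c : R := (2 / (1 + u ^+ 3)) `^ (1 / 3).
have c3 : c ^+ 3 = 2 / (1 + u ^+ 3).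
  by rewrite -powR_mulrn ?powR_ge0// -powRrM mul1r mulVf// powRr1.
have qE : Num.sqrt (1 - 4 * X u / 27) = (1 - u ^+ 3) / (1 + u ^+ 3).
  rewrite -[RHS]ger0_norm ?divr_ge0 ?ltW// -sqrtr_sqr; congr Num.sqrt.
  by rewrite /cubic_map; field; exact: lt0r_neq0.
exists c; split => //.
- by rewrite powR_gt0// divr_gt0.
- rewrite exprMn -exprM mulnC exprM c3 /cubic_map.
  by field; exact: lt0r_neq0.
- by rewrite qE c3; field; exact: lt0r_neq0.
- rewrite sqrtrM// qE; congr (_ * _).
  by apply/esym/(mulIf (_ : Num.sqrt 3 != 0)); rewrite ?gt_eqF ?sqrtr_gt0//
    divfK ?gt_eqF ?sqrtr_gt0// -expr2 sqr_sqrtr.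
Qed.

Lemma raney_density_weight0 u : 0 < u < 1 ->
  raney_density 9 (1 / 3) (- (2 / 3)) (- (1 / 3)) (X u) *
    (81 * u ^+ 2 * (1 - u ^+ 3) / (1 + u ^+ 3) ^+ 3) = weight0 u.
Proof.
move=> /[dup] u01 /andP[u0 u1].
have [c [c0 c3 zE sE dE]] := cubic_map_substitution u01.
have v0 : 0 < c ^+ 2 * u by rewrite mulr_gt0// exprn_gt0.
have cn := lt0r_neq0 c0; have un := lt0r_neq0 u0.
have tn := lt0r_neq0 (cube_add1_gt0 (ltW u0)).
have t1n : 1 - u ^+ 3 != 0.
  by apply/lt0r_neq0; rewrite subr_gt0 exprn_ilt1// ltW.
have qn := lt0r_neq0 (quad_gt0 u).
have sn : Num.sqrt 3 != 0 :> R by rewrite gt_eqF// sqrtr_gt0.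
have pn : pi != 0 :> R by rewrite gt_eqF// pi_gt0.
rewrite /raney_density dE sE zE !powRN !powR_cube_third ?ltW//.
rewrite powR_cube_two_thirds ?ltW// /weight0.
move: pi (Num.sqrt 3) pn sn => p q pn sn.
(* The two terms are c/(c^2 u)^2 and 1/(c c^2 u). Both carry c^(-3), so c enters only through its
   cube, which is rational in u. *)
transitivity ((c ^+ 3)^-1 * (u ^- 2 + u ^-1) /
   (9 * (p * (3 / q * ((1 - u ^+ 3) / (1 + u ^+ 3))))) *
    (81 * u ^+ 2 * (1 - u ^+ 3) / (1 + u ^+ 3) ^+ 3)).
  by field; rewrite cn un tn t1n sn pn.
by rewrite c3; field; rewrite un tn t1n sn pn qn.
Qed.

(** Here c cancels entirely: the two products of powers are 1/u and u. *)
Lemma raney_density_weight1 u : 0 < u < 1 ->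
  raney_density 6 (2 / 3) (- (1 / 3)) (1 / 3) (X u) *
    (81 * u ^+ 2 * (1 - u ^+ 3) / (1 + u ^+ 3) ^+ 3) = weight1 u.
Proof.
move=> /[dup] u01 /andP[u0 u1].
have [c [c0 c3 zE sE dE]] := cubic_map_substitution u01.
have v0 : 0 < c ^+ 2 * u by rewrite mulr_gt0// exprn_gt0.
have cn := lt0r_neq0 c0; have un := lt0r_neq0 u0.
have tn := lt0r_neq0 (cube_add1_gt0 (ltW u0)).
have t1n : 1 - u ^+ 3 != 0.
  by apply/lt0r_neq0; rewrite subr_gt0 exprn_ilt1// ltW.
have sn : Num.sqrt 3 != 0 :> R by rewrite gt_eqF// sqrtr_gt0.
have pn : pi != 0 :> R by rewrite gt_eqF// pi_gt0.
rewrite /raney_density dE sE zE !powRN !powR_cube_third ?ltW//.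
rewrite powR_cube_two_thirds ?ltW// /weight1.
by move: pi (Num.sqrt 3) pn sn => p q pn sn; field; rewrite cn un tn t1n sn pn.
Qed.

(** Multiplying the powers of z in the first density by z gives those in the third. With the
    constants 9 and 4, the third density is x/3 times the first, which reduces the claim to
    [weight0]. *)
Lemma raney_density_weight2 u : 0 < u < 1 ->
  raney_density 4 (1 / 3) (1 / 3) (2 / 3) (X u) *
    (81 * u ^+ 2 * (1 - u ^+ 3) / (1 + u ^+ 3) ^+ 3) = weight2 u.
Proof.
move=> /[dup] u01 /andP[u0 u1].
have [c [c0 c3 zE sE dE]] := cubic_map_substitution u01.
have v0 : 0 < c ^+ 2 * u by rewrite mulr_gt0// exprn_gt0.
have cn := lt0r_neq0 c0; have un := lt0r_neq0 u0.
have tn := lt0r_neq0 (cube_add1_gt0 (ltW u0)).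
have t1n : 1 - u ^+ 3 != 0.
  by apply/lt0r_neq0; rewrite subr_gt0 exprn_ilt1// ltW.
rewrite /weight2 -raney_density_weight0// [RHS]mulrA; congr (_ * _).
have -> : X u = 27 / 4 * (c ^+ 2 * u) ^+ 3 by rewrite -zE; field.
rewrite /raney_density.
rewrite (_ : 4 * (27 / 4 * (c ^+ 2 * u) ^+ 3) / 27 = (c ^+ 2 * u) ^+ 3);
  last by field.
rewrite -zE dE sE zE !powRN !powR_cube_third ?ltW//.
rewrite !powR_cube_two_thirds ?ltW//.
have sn : Num.sqrt 3 != 0 :> R by rewrite gt_eqF// sqrtr_gt0.
have pn : pi != 0 :> R by rewrite gt_eqF// pi_gt0.
by move: pi (Num.sqrt 3) pn sn => p q pn sn; field; rewrite cn un tn t1n sn pn.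
Qed.

End explicit_density.

(** * Identification of the chosen measure and of its chosen density *)

Section density_of_nu.
Context {R : realType}.
Local Notation leb := (@lebesgue_measure R).
Local Notation X := (@cubic_map R).

Lemma support_end3 : support_end 3 = 27 / 4 :> R.
Proof.
rewrite /support_end (_ : 3 - 1 = 2 :> R); last by lra.
rewrite (_ : 1 - 3 = - 2 :> R); last by lra.
by rewrite powRN !powR_mulrn//; lra.
Qed.

(** If the functions differed at x, by continuity they would differ on a ball around x, which has
    positive Lebesgue measure. *)
Lemma continuous_ae_eq (f g : R -> R) (a b x : R) :
  (forall x, a < x < b -> {for x, continuous f}) ->
  (forall x, a < x < b -> {for x, continuous g}) ->
  ae_eq leb setT (EFin \o f) (EFin \o g) -> a < x < b -> f x = g x.
Proof.
move=> cf cg fg xab; apply/eqP; apply: contrapT => /negP fgx.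
have cd : {for x, continuous (fun y => `|f y - g y|)}.
  apply: (@continuous_comp _ _ _ (fun y => f y - g y) Num.norm).
    by apply: continuousB; [exact: cf|exact: cg].
  exact: norm_continuous.
have d0 : 0 < `|f x - g x| by rewrite normr_gt0 subr_eq0.
have /nbhs_ballP[e /= e0 eB] : \forall y \near x, 0 < `|f y - g y|.
  exact: (cvgr_gt _ cd).
case: fg => N [mN N0 sN].
have : (leb (ball x e) <= leb N)%E.
  apply: le_measure; rewrite ?inE//; first exact: measurable_ball.
  move=> y /eB; rewrite normr_gt0 subr_eq0 => fgy; apply: sN => /= h.
  by move: fgy; have [->] := h I; rewrite eqxx.
have -> : leb N = 0%:E by [].
have -> : leb (ball x e) = (e *+ 2)%:E by rewrite lebesgue_measure_ball// ltW.
by rewrite lee_fin leNgt mulrn_wgt0.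
Qed.

(** Both [nu] and [V] are picked by [get]. Each time, existence shows that the pick has the required
    property, and uniqueness identifies it with the explicit candidate. *)
Lemma V_eq_density (r : R) (F w : R -> R) :
  (forall x, 0 <= F x) ->
  (forall x, 0 < x < 27 / 4 -> {for x, continuous F}) ->
  (forall u, 0 < u < 1 ->
    F (X u) * (81 * u ^+ 2 * (1 - u ^+ 3) / (1 + u ^+ 3) ^+ 3) = w u) ->
  (forall u, 0 <= u -> {for u, continuous w}) ->
  (forall n, moment w n = gbinom (n%:R * 3 + r) n) ->
  forall x, 0 < x < 27 / 4 -> V 3 r x = F x.
Proof.
move=> F0 cF Fw cw mw x xI.
pose D : set R := `]0%R, (27 / 4)%R[%classic.
(* Outside [D] the formula takes irrelevant values, so it is cut off to 0. As [D] is open,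
   continuity on it survives. *)
pose G := F \_ D.
have mD : measurable D by exact: measurable_itv.
have G0 y : 0 <= G y by rewrite /G patchE; case: ifP.
have mG : measurable_fun [set: R] G.
  apply/(measurable_restrictT F) => //.
  apply: subspace_continuous_measurable_fun => //.
  apply: continuous_in_subspaceT => y; rewrite inE /D /= in_itv/=.
  exact: cF.
have GE y : 0 < y < 27 / 4 -> G y = F y.
  by move=> yI; rewrite /G patchE mem_set//= in_itv.
have Gout y : ~ D y -> G y = 0 by move=> yD; rewrite /G patchE memNset.
have cG y : 0 < y < 27 / 4 -> {for y, continuous G}.
  move=> yI; rewrite /prop_for /continuous_at GE//.
  apply: cvg_trans (cF _ yI); apply: near_eq_cvg.
  have : y \in `]0, 27 / 4[ by rewrite in_itv.
  move=> /near_in_itvoo; apply: filterS => t /=.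
  by rewrite in_itv/= => tI; rewrite GE.
have IG n : (\int[leb]_x (x ^+ n * G x)%:E = (moment w n)%:E)%E.
  transitivity (\int[leb]_(x in D) (x ^+ n * F x)%:E)%E.
    rewrite [RHS]integral_mkcond; apply: eq_integral => y _.
    by rewrite patchE /G patchE; case: ifP => //; rewrite mulr0.
  rewrite (@integral_cubic_map _ _ (fun u => X u ^+ n * w u)).
  - rewrite /moment /Rintegral fineK//.
    exact: integrable_fin_num (integrable_moment n cw).
  - by move=> y /andP[/ltW y0 _]; rewrite mulr_ge0// exprn_ge0.
  - move=> y yI.
    exact: (@continuousM R R (fun t => t ^+ n) F y
      (@exprn_continuous R n y) (cF y yI)).
  - by move=> u uI; rewrite -mulrA Fw.
  - by move=> u u0; exact/continuous_cubic_mapX_mul/cw.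
have xG0 n y : 0 <= y ^+ n * G y.
  have [yD|yD] := pselect (D y); last by rewrite Gout// mulr0.
  have : y \in `]0, 27 / 4[ by [].
  by rewrite in_itv/= => /andP[/ltW y0 _]; rewrite mulr_ge0// exprn_ge0.
have mxG n : measurable_fun [set: R] (fun x => x ^+ n * G x).
  by apply: measurable_funM => //; exact: exprn_measurable.
have iG n : leb.-integrable setT (fun x => (x ^+ n * G x)%:E).
  apply/integrableP; split; first by apply/measurable_EFinP; exact: mxG.
  rewrite (_ : (\int[leb]_x _)%E = (\int[leb]_x (x ^+ n * G x)%:E)%E).
    by rewrite IG ltry.
  by apply: eq_integral => y _ /=; rewrite ger0_norm.
have G1 : (\int[leb]_x (G x)%:E = 1)%E.
  transitivity (\int[leb]_x (x ^+ 0 * G x)%:E)%E.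
    by apply: eq_integral => y _; rewrite expr0 mul1r.
  by rewrite IG mw /gbinom big_ord0 fact0 divr1.
have [P PG] := density_probability mG G0 G1.
have mom n := integral_density mG G0 PG (@exprn_measurable R setT n) (iG n).
have Pm : has_binomial_moments 3 r P.
  by move=> n; have [iP eP] := mom n; split => //; rewrite eP IG mw.
(* [P] witnesses that the set is inhabited, so the measure picked by [get] belongs to it. *)
have num : has_binomial_moments 3 r (nu 3 r).
  rewrite /nu; apply: (@getPex _ [set mu | has_binomial_moments 3 r mu]).
  by exists P.
have nuG A : measurable A -> nu 3 r A = (\int[leb]_(x in A) (G x)%:E)%E.
  move=> mA; rewrite -PG//; apply/esym; move: A mA.
  (* [G] has mass 1 and vanishes outside ]0, 27/4[, so the moment of order 2n is at most
     (27/4)^(2n). *)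
  apply: (@moment_determinacy _ _ _ 1 (27 / 4)) => //.
  - by move=> n; have [] := Pm n.
  - by move=> n; have [] := num n.
  - by move=> n; have [_ ->] := Pm n; have [_ ->] := num n.
  - move=> n; have [_ ->] := mom (2 * n)%N; rewrite mul1r.
    have c0 : 0 <= (27 / 4 : R) ^+ (2 * n) by rewrite exprn_ge0.
    apply: (@le_trans _ _ (\int[leb]_x ((27 / 4) ^+ (2 * n) * G x)%:E)%E).
      apply: ge0_le_integral => //.
      + by move=> y _; rewrite lee_fin.
      + by apply/measurable_EFinP; exact: mxG.
      + by apply/measurable_EFinP; apply: measurable_funM.
      + move=> y _; rewrite lee_fin.
        have [yD|yD] := pselect (D y); last by rewrite Gout// !mulr0.
        have : y \in `]0, 27 / 4[ by [].
        rewrite in_itv/= => /andP[/ltW y0 /ltW y1]; rewrite ler_wpM2r//.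
        by rewrite lerXn2r// nnegrE.
    under eq_integral do rewrite EFinM.
    rewrite ge0_integralZl//; last first.
    + by move=> y _; rewrite lee_fin.
    + exact/measurable_EFinP.
    by rewrite G1 mule1.
have densG : is_cont_density 3 (nu 3 r) G.
  by split => //; rewrite support_end3.
have [mV V0 nuV cV] : is_cont_density 3 (nu 3 r) (V 3 r).
  rewrite /V; apply: (@getPex _ [set f | is_cont_density 3 (nu 3 r) f]).
  by exists G.
(* [V 3 r] and [G] have the same integral over every measurable set, hence agree almost everywhere.
   Continuity upgrades this to every point of the interval. *)
rewrite -GE//; apply: (@continuous_ae_eq _ _ 0 (27 / 4)) => //.
  by move=> y yI; apply: cV; rewrite support_end3.
apply: ae_eq_sym; apply: integral_ae_eq => //.
- apply/integrableP; split; first exact/measurable_EFinP.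
  rewrite (_ : (\int[leb]_x _)%E = (\int[leb]_x (G x)%:E)%E).
    by rewrite G1 ltry.
  by apply: eq_integral => y _ /=; rewrite ger0_norm.
- exact/measurable_EFinP.
- by move=> A _ mA; rewrite -nuV// -nuG.
Qed.

End density_of_nu.

Theorem theorem5p1 (R : realType) (x : R) (hx : 0 < x < 27 / 4) :
  let z := 4 * x / 27 in
  let s := 1 + Num.sqrt (1 - z) in
  let d := pi * Num.sqrt (3 * (1 - z)) in
  [/\ V 3 0 x = s `^ (1 / 3) / (9 * d) * z `^ (- (2 / 3))
              + s `^ (- (1 / 3)) / (9 * d) * z `^ (- (1 / 3)),
      V 3 1 x = s `^ (2 / 3) / (6 * d) * z `^ (- (1 / 3))
              + s `^ (- (2 / 3)) / (6 * d) * z `^ (1 / 3) &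
      V 3 2 x = s `^ (1 / 3) / (4 * d) * z `^ (1 / 3)
              + s `^ (- (1 / 3)) / (4 * d) * z `^ (2 / 3)].
Proof.
move=> z s d; split.
- rewrite (@V_eq_density _ 0
    (raney_density 9 (1 / 3) (- (2 / 3)) (- (1 / 3))) weight0)//.
  + by move=> y; exact: raney_density_ge0.
  + by move=> y; exact: continuous_raney_density.
  + exact: raney_density_weight0.
  + by move=> u _; exact: continuous_weight0.
  + exact: moment_weight0_gbinom.
- rewrite (@V_eq_density _ 1
    (raney_density 6 (2 / 3) (- (1 / 3)) (1 / 3)) weight1)//.
  + by move=> y; exact: raney_density_ge0.
  + by move=> y; exact: continuous_raney_density.
  + exact: raney_density_weight1.
  + exact: continuous_weight1.
  + exact: moment_weight1_gbinom.
- rewrite (@V_eq_density _ 2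
    (raney_density 4 (1 / 3) (1 / 3) (2 / 3)) weight2)//.
  + by move=> y; exact: raney_density_ge0.
  + by move=> y; exact: continuous_raney_density.
  + exact: raney_density_weight2.
  + exact: continuous_weight2.
  + exact: moment_weight2_gbinom.
Qed.
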